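(* Let $q\in\mathbb{N}$ and $B\ge0$ be such that $\mathrm{e}^{-B}(q-1)>1$. Let $W$ be a random variable with $\mathbb{E}[W]>0$ and with probability density of the form $$f_W(w)=C\,w^p\,\mathrm{e}^{-\varphi(w)}\,\mathbf{1}_{[b,c)}(w),\qquad 0\le b<c\le\infty,\ p\in\mathbb{R},\ C\ge0,\ \varphi\ge0,$$ and assume that there exist $D>0$ and $\tau>2$ with $\mathbb{P}(W>w)\le D\,w^{-(\tau-1)}$ for all $w\ge1$. Assume moreover that one of the following holds: (i) $0<b<c<\infty$, $\varphi\in C^2([b,c])$, and $w\varphi'(w)$ is non-negative and non-decreasing in $w\in[b,c]$; (ii) $b>0$, $c=\infty$, $\varphi\in C^2([b,\infty))$, and $w\varphi'(w)$ is non-negative and non-decreasing in $w\in[b,\infty)$ with $\lim_{w\to\infty}w\varphi'(w)=\infty$; (iii) $b=0$, $c<\infty$, $p>-1$, $\varphi\in C^2([0,c])$, and $w\varphi'(w)$ is non-negative and non-decreasing in $w\in[0,c]$; (iv) $b=0$, $c=\infty$, $p>-1$, $\varphi\in C^2([0,\infty))$, and $w\varphi'(w)$ is non-negative and non-decreasing in $w\in[0,\infty)$ with $\lim_{w\to\infty}w\varphi'(w)=\infty$. Then the function $t\mapsto\frac{d^2}{dt^2}\mathscr{F}_B(t)$ is first positive and then negative.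
   Context: For $t\ge0$, $\mathscr{F}_B(t)=\mathbb{E}\Big[\frac{W}{\mathbb{E}[W]}\,\frac{\mathrm{e}^{tW+B}-1}{\mathrm{e}^{tW+B}+q-1}\Big]$. ''First positive and then negative'' means that there is a $t_*>0$ with $\frac{d^2}{dt^2}\mathscr{F}_B(t)>0$ for $0<t<t_*$ and $\frac{d^2}{dt^2}\mathscr{F}_B(t)<0$ for $t>t_*$. *)

(* Defs.v *)
From HB Require Import structures.
From mathcomp Require Import all_boot all_order all_algebra.
From mathcomp Require Import all_classical all_reals all_analysis.
Set Implicit Arguments.
Unset Strict Implicit.
Unset Printing Implicit Defensive.
Import Order.TTheory GRing.Theory Num.Theory.
Import numFieldNormedType.Exports.
Local Open Scope classical_set_scope.
Local Open Scope ring_scope.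

(* Real points of [b, c) and of [b, c]; the right end point may be +oo, in
   which case both are [b, +oo). *)
Definition itv_co (R : realType) (b : R) (c : \bar R) : set R :=
  [set w | b <= w /\ (w%:E < c)%E].

Definition itv_cc (R : realType) (b : R) (c : \bar R) : set R :=
  [set w | b <= w /\ (w%:E <= c)%E].

(* Derivative relative to I, so one-sided at the end points of an interval;
   it does not depend on the values of f outside I. *)
Definition quot_within (R : realType) (f : R -> R) (x y : R) : R :=
  (f y - f x) / (y - x).

Definition derivable_within (R : realType) (I : set R) (f : R -> R) (x : R) :
    Prop :=
  cvg (quot_within f x y @[y --> within I x^']).

Definition derive_within (R : realType) (I : set R) (f : R -> R) (x : R) : R :=
  lim (quot_within f x y @[y --> within I x^']).

Definition C2_on (R : realType) (I : set R) (f : R -> R) : Prop :=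
  [/\ (forall x, I x -> derivable_within I f x),
      (forall x, I x -> derivable_within I (derive_within I f) x) &
      {within I, continuous (derive_within I (derive_within I f))}].

Definition nonneg_on (R : realType) (I : set R) (g : R -> R) : Prop :=
  forall x, I x -> 0 <= g x.

Definition nondecreasing_on (R : realType) (I : set R) (g : R -> R) : Prop :=
  forall x y, I x -> I y -> x <= y -> g x <= g y.

Definition has_density (d : measure_display) (T : measurableType d)
    (R : realType) (P : probability T R) (X : {RV P >-> R}) (f : R -> R) :
    Prop :=
  [/\ measurable_fun setT f, (forall x, 0 <= f x) &
      forall A : set R, measurable A ->
        distribution P X A
        = (\int[@lebesgue_measure R]_(x in A) (f x)%:E)%E].

(* At w = 0 with p < 0, powR gives 0; this is a Lebesgue-null point. *)
Definition weight_density (R : realType) (C p : R) (phi : R -> R) (b : R)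
    (c : \bar R) (w : R) : R :=
  C * w `^ p * expR (- phi w) * \1_(itv_co b c) w.

Definition potts_F (d : measure_display) (T : measurableType d) (R : realType)
    (P : probability T R) (W : {RV P >-> R}) (q : nat) (B t : R) : R :=
  fine 'E_P[(fun x : T => W x / fine 'E_P[W]%E
    * ((expR (t * W x + B) - 1) / (expR (t * W x + B) + q%:R - 1)))%R]%E.

Definition first_positive_then_negative (R : realType) (g : R -> R) : Prop :=
  exists tstar : R, [/\ 0 < tstar,
    (forall t, 0 < t -> t < tstar -> 0 < g t) &
    (forall t, tstar < t -> g t < 0)].

(* Main.v *)
Require Import Defs.
From HB Require Import structures.
From mathcomp Require Import all_boot all_order all_algebra.
From mathcomp Require Import all_classical all_reals all_analysis.
From mathcomp Require Import measurable_realfun lebesgue_integral_under.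
From mathcomp Require Import ring lra.
Import Order.TTheory GRing.Theory Num.Theory.
Import numFieldNormedType.Exports.
Local Open Scope classical_set_scope.
Local Open Scope ring_scope.

(* With a = e^{-B} (q - 1) and k(x) = e^x (a - e^x) / (e^x + a)^3, one has
   F''(t) = const * E[W^3 k(t W)] with a positive constant, and k is positive
   before ln a > 0 and negative after. The density of ln W is log-concave, as
   w phi'(w) is nondecreasing, so the kernel (t, x) |-> g(x / t), with g the
   density times w^3, is totally positive of order 2. Comparing g(x / t1) and
   g(x / t2) with their values at x = ln a shows that F''(t1) <= 0 implies
   F''(t2) < 0 for t1 < t2. As t -> 0, E[W^3 k(t W)] tends to k(0) E[W^3] > 0.
   Finally F'' cannot be positive everywhere: F' would then be at least
   F'(1) > 0 on [1, oo), although F is bounded. *)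

Set Implicit Arguments.
Unset Strict Implicit.
Unset Printing Implicit Defensive.

(** * The kernel of the second derivative *)

Section logistic.
Context {R : realType} (a : R).
Hypothesis a0 : 0 < a.

(** [a * slope x] is the derivative of the logistic function e^x / (e^x + a). *)
Definition slope (x : R) : R := expR x / (expR x + a) ^+ 2.
Definition curvature (x : R) : R :=
  expR x * (a - expR x) / (expR x + a) ^+ 3.

Let den_gt0 (x : R) : 0 < expR x + a.
Proof. by rewrite addr_gt0 ?expR_gt0. Qed.

Lemma is_derive_inv_expRD (x : R) :
  is_derive x (1 : R) (fun y : R => (expR y + a)^-1) (- slope x).
Proof.
apply: is_derive_eq; first by apply: is_deriveV; rewrite gt_eqF.
by rewrite /slope /GRing.scale/= addr0; field; rewrite gt_eqF.
Qed.

Lemma is_derive_slope (x : R) : is_derive x (1 : R) slope (curvature x).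
Proof.
pose v y : R := (expR y + a)^-1.
have -> : slope = expR * (v ^+ 2).
  by apply/funext => y; rewrite /slope /v !fctE exprVn.
have dv := is_derive_inv_expRD x; rewrite -/v in dv.
apply: is_derive_eq.
rewrite /curvature /slope /v /GRing.scale/= !fctE.
by field; rewrite gt_eqF.
Qed.

Lemma inv_expRD_bound x : 0 <= (expR x + a)^-1 <= a^-1.
Proof.
rewrite invr_ge0 ltW//= lef_pV2 ?posrE//.
by rewrite lerDr expR_ge0.
Qed.

Lemma slope_gt0 x : 0 < slope x.
Proof. by rewrite divr_gt0 ?expR_gt0 ?exprn_gt0. Qed.

Lemma slope_le x : slope x <= a^-1.
Proof.
have e0 := expR_gt0 x.
rewrite /slope ler_pdivrMr ?exprn_gt0// mulrC ler_pdivlMr//.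
(* The claim is now a e^x <= (e^x + a)^2; the expanded square contains 2 a e^x and otherwise only
   positive terms. *)
by have := a0; nra.
Qed.

(** [curvature] is [slope] times (a - e^x) / (e^x + a), a factor of modulus at most 1. *)
Lemma curvature_bound x : `|curvature x| <= a^-1.
Proof.
apply: le_trans (slope_le x); have e0 := expR_gt0 x.
have -> : curvature x = slope x * ((a - expR x) / (expR x + a)).
  by rewrite /curvature /slope; field; rewrite gt_eqF.
rewrite normrM gtr0_norm ?slope_gt0// ler_piMr//; first exact/ltW/slope_gt0.
rewrite normrM normfV (gtr0_norm (den_gt0 x)) ler_pdivrMr// mul1r.
by have := a0; rewrite ler_norml; move=> a0_; apply/andP; split; lra.
Qed.

Lemma curvature_gt0 x : expR x < a -> 0 < curvature x.
Proof. by move=> xa; rewrite divr_gt0 ?exprn_gt0// mulr_gt0 ?expR_gt0 ?subr_gt0. Qed.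

Lemma curvature_lt0 x : a < expR x -> curvature x < 0.
Proof.
move=> xa; rewrite /curvature pmulr_llt0 ?invr_gt0 ?exprn_gt0//.
by rewrite pmulr_rlt0 ?expR_gt0// subr_lt0.
Qed.

Lemma continuous_curvature : continuous curvature.
Proof.
move=> x; apply: cvgM; first apply: cvgM.
- exact: continuous_expR.
- by apply: cvgB; [exact: cvg_cst|exact: continuous_expR].
- apply: cvgV; first by rewrite gt_eqF ?exprn_gt0.
  apply: (@continuous_comp _ _ _ (fun y => expR y + a) (fun z => z ^+ 3)).
    by apply: cvgD; [exact: continuous_expR|exact: cvg_cst].
  exact: exprn_continuous.
Qed.

End logistic.

(** * Differentiating moments under the expectation *)

Section moments.
Context {R : realType} {d : measure_display} {T : measurableType d}.
Variables (P : probability T R) (X : T -> R).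
Hypothesis mX : measurable_fun setT X.
Hypothesis X3 : P.-integrable setT (fun x => (`|X x| ^+ 3)%:E).

(** For [n <= 3], |X|^n <= 1 + |X|^3, by separating |X| <= 1 from |X| > 1; constants are integrable
    because [P] is finite. *)
Lemma integrable_moment (n : nat) (u : R -> R) (M t : R) : (n <= 3)%N ->
  continuous u -> (forall x, `|u x| <= M) ->
  P.-integrable setT (fun x => (X x ^+ n * u (t * X x))%:E).
Proof.
move=> n3 cu uM.
have M0 : 0 <= M by exact: le_trans (uM 0).
apply: (@le_integrable _ _ _ P _ measurableT _
  (fun x => (M * (1 + `|X x| ^+ 3))%:E)).
- apply/measurable_EFinP/measurable_funM; first exact: measurable_funX.
  apply: (measurableT_comp (continuous_measurable_fun cu)).
  exact: measurable_funM.
- move=> x _; rewrite /= lee_fin [leRHS]ger0_norm; last first.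
    by rewrite mulr_ge0 ?addr_ge0 ?exprn_ge0.
  rewrite normrM mulrC ler_pM// normrX.
  have [X1|X1] := leP `|X x| 1.
    by rewrite ler_wpDr ?exprn_ge0// exprn_ile1.
  by rewrite ler_wpDl// ler_weXn2l// ltW.
- under eq_fun do rewrite EFinM EFinD.
  apply: integrableZl => //; apply: integrableD => //.
  exact: finite_measure_integrable_cst.
Qed.

(** Dominated differentiation: the derivative of the integrand in [s] is at most M |X|^(n+1) for
    every [s], and [n < 3] makes this bound integrable. *)
Lemma is_derive_moment (n : nat) (u u' : R -> R) (M t : R) : (n < 3)%N ->
  (forall x : R, is_derive x (1 : R) u (u' x)) -> continuous u' ->
  (forall x, `|u x| <= M) -> (forall x, `|u' x| <= M) ->
  is_derive t (1 : R) (fun s => \int[P]_x (X x ^+ n * u (s * X x)))%R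
    (\int[P]_x (X x ^+ n.+1 * u' (t * X x)))%R.
Proof.
move=> n3 du cu' uM u'M.
have M0 : 0 <= M by exact: le_trans (uM 0).
have cu : continuous u.
  by move=> x; apply/differentiable_continuous/derivable1_diffP; apply: ex_derive.
pose f s x := X x ^+ n * u (s * X x).
have df (s : R) x : is_derive s (1 : R) (f^~ x) (X x ^+ n.+1 * u' (s * X x)).
  have dm : is_derive s (1 : R) (fun s => s * X x) (X x).
    apply: (is_derive_eq (is_deriveM (is_derive_id _ _) (is_derive_cst _ _ _))).
    by rewrite scaler0 add0r /GRing.scale/= mulr1.
  have dc := is_deriveZ (X x ^+ n)
    (@is_derive1_comp _ u (fun s => s * X x) _ _ _ (du (s * X x)) dm).
  by apply: is_derive_eq dc _; rewrite /GRing.scale/= exprS; ring.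
have d1E s x : partial1of2 f s x = X x ^+ n.+1 * u' (s * X x).
  by rewrite partial1of2E; apply: derive_val.
(* Any neighbourhood of [t] would do, the domination being uniform in [s]. *)
have tI : `]t - 1, t + 1[%classic t by rewrite /= in_itv/=; apply/andP; split; lra.
have H1 : forall s, `]t - 1, t + 1[%classic s -> P.-integrable setT (EFin \o f s).
  by move=> s _; apply: (@integrable_moment n u M) => //; exact: ltnW.
have H2 s x : `]t - 1, t + 1[%classic s -> [set: T] x -> derivable (f^~ x) s 1.
  by move=> _ _; apply: ex_derive.
have G0 x : 0 <= M * `|X x| ^+ n.+1 by rewrite mulr_ge0.
have HG : P.-integrable setT (EFin \o (fun x => M * `|X x| ^+ n.+1)).
  rewrite /comp; under eq_fun do rewrite EFinM.
  apply: integrableZl => //.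
  (* With the constant 1 for [u] and a dummy parameter 0, this is integrability of the bare power of
     [X]. *)
  have /integrable_norm : P.-integrable setT
      (fun x => (X x ^+ n.+1 * (cst 1 (0 * X x) : R))%:E).
    apply: (@integrable_moment _ _ 1) => //; first by move=> x; apply: cvg_cst.
    by move=> x; rewrite normr1.
  apply: eq_integrable => // x _.
  by rewrite /= mulr1 normrX.
have Gub s x : `]t - 1, t + 1[%classic s -> [set: T] x ->
    `|partial1of2 f s x| <= M * `|X x| ^+ n.+1.
  by move=> _ _; rewrite d1E normrM normrX mulrC ler_wpM2r.
have dI := derivable_under_integral measurableT tI H1 H2 G0 HG Gub.
have eI := differentiation_under_integral measurableT tI H1 H2 G0 HG Gub.
apply: DeriveDef => //.
rewrite -derive1E eI; apply: eq_Rintegral => x _.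
by rewrite /= d1E.
Qed.

Lemma continuous_moment (n : nat) (u : R -> R) (M t : R) : (n <= 3)%N ->
  continuous u -> (forall x, `|u x| <= M) ->
  {for t, continuous (fun s : R => \int[P]_x (X x ^+ n * u (s * X x)))%R}.
Proof.
move=> n3 cu uM.
have M0 : 0 <= M by exact: le_trans (uM 0).
have HG : P.-integrable setT (EFin \o (fun x => M * `|X x| ^+ n)).
  rewrite /comp; under eq_fun do rewrite EFinM.
  apply: integrableZl => //.
  have /integrable_norm : P.-integrable setT
      (fun x => (X x ^+ n * (cst 1 (0 * X x) : R))%:E).
    apply: (@integrable_moment _ _ 1) => //; first by move=> x; apply: cvg_cst.
    by move=> x; rewrite normr1.
  apply: eq_integrable => // x _.
  by rewrite /= mulr1 normrX.
apply: (@continuity_under_integral _ _ _ P (fun s x => X x ^+ n * u (s * X x))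
  setT measurableT (t - 1) (t + 1) _ _ _ HG).
- by move=> s _; exact: integrable_moment uM.
- apply: aeW => x _ s _; apply: cvgM; first exact: cvg_cst.
  have cc : {for s, continuous (u \o (fun y : R => y * X x))}.
    apply: continuous_comp; last exact: cu.
    by apply: cvgM; [exact: cvg_id|exact: cvg_cst].
  exact: cc.
- move=> s _; apply: aeW => x _.
  by rewrite normrM normrX mulrC ler_wpM2r.
- by rewrite inE/= in_itv/=; apply/andP; split; lra.
Qed.

End moments.

(** * Densities and scaling of the Lebesgue measure *)

Section density.
Context {R : realType} {d : measure_display} {T : measurableType d}.
Variables (P : probability T R) (W : {RV P >-> R}) (f : R -> R).
Hypothesis Wf : has_density W f.
Local Notation mu := (@lebesgue_measure R).

Let mf : measurable_fun setT f. Proof. by case: Wf. Qed.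
Let f0 x : 0 <= f x. Proof. by case: Wf. Qed.

(* The law of [W] seen on the measurable type carrying the Lebesgue measure,
   whose display differs from the one of [R]. *)
Let mW : measurable_fun setT (W : T -> measurableTypeR R).
Proof. exact: measurable_funP W. Qed.
Let W' : {RV P >-> measurableTypeR R} :=
  HB.pack (W : T -> measurableTypeR R) (isMeasurableFun.Build _ _ _ _ _ mW).

Let distE (A : set (measurableTypeR R)) : measurable A ->
  distribution P W' A = (\int[mu]_(x in A) (f x)%:E)%E.
Proof. by case: Wf => _ _; exact. Qed.

Lemma has_density_dominated : distribution P W' `<< mu.
Proof.
apply/null_content_dominatesP => A mA A0; rewrite distE//.
by apply: null_set_integral => //; apply/measurable_EFinP/measurable_funTS.
Qed.

(** [f] agrees almost everywhere with the Radon-Nikodym derivative of the law of [W], as both have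
    the same integral over every measurable set; the change of variables for that derivative then
    transfers to [f]. *)
Lemma ge0_integral_density (v : R -> R) : measurable_fun setT v ->
  (forall x, 0 <= v x) ->
  (\int[mu]_w (v w * f w)%:E = \int[P]_x (v (W x))%:E)%E.
Proof.
move=> mv v0.
have dom := has_density_dominated.
transitivity (\int[distribution P W']_y (v y)%:E)%E; last first.
  apply: ge0_integral_distribution; first exact/measurable_EFinP.
  by move=> y; rewrite lee_fin.
rewrite -(@Radon_Nikodym_SigmaFinite.change_of_variables _ _ _ _ mu dom)//;
  last exact/measurable_EFinP.
under eq_integral do rewrite EFinM.
apply: ae_eq_integral => //.
- by apply: emeasurable_funM => //; exact/measurable_EFinP.
- apply: emeasurable_funM; first exact/measurable_EFinP.
  exact: measurable_int (Radon_Nikodym_SigmaFinite.f_integrable dom).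
- apply: ae_eqe_mul2l; apply: ae_eq_sym; apply: integral_ae_eq => //.
  + exact: Radon_Nikodym_SigmaFinite.f_integrable.
  + exact/measurable_EFinP.
  + move=> E _ mE.
    rewrite -Radon_Nikodym_SigmaFinite.f_integral//; exact: distE.
Qed.

Lemma integrable_density (v : R -> R) : measurable_fun setT v ->
  P.-integrable setT (fun x => (v (W x))%:E) ->
  mu.-integrable setT (fun w => (v w * f w)%:E).
Proof.
move=> mv /integrableP[_ iv]; apply/integrableP; split.
  exact/measurable_EFinP/measurable_funM.
apply: le_lt_trans iv.
under eq_integral do rewrite /= normrM (ger0_norm (f0 _)).
rewrite (@ge0_integral_density (fun w => `|v w|))//.
exact: measurableT_comp.
Qed.

Lemma Rintegral_density (v : R -> R) : measurable_fun setT v ->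
  P.-integrable setT (fun x => (v (W x))%:E) ->
  \int[mu]_w (v w * f w) = \int[P]_x v (W x).
Proof.
move=> mv iv.
(* The positive and negative parts of [v] are integrable and fall under the nonnegative case. *)
pose vp w := Num.max (v w) 0; pose vn w := Num.max (- v w) 0.
have mvp : measurable_fun setT vp by exact: measurable_funrpos.
have mvn : measurable_fun setT vn by exact: measurable_funrneg.
have vpn w : v w = vp w - vn w.
  by rewrite /vp /vn; case: (leP (v w) 0); case: (leP (- v w) 0); lra.
have vp0 w : 0 <= vp w by rewrite le_max lexx orbT.
have vn0 w : 0 <= vn w by rewrite le_max lexx orbT.
have ivp : P.-integrable setT (fun x => (vp (W x))%:E).
  apply: le_integrable iv => //.
    by apply/measurable_EFinP; exact: (measurableT_comp mvp).
  move=> x _; rewrite lee_fin ger0_norm// /vp.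
  by rewrite ge_max normr_ge0 ler_norm.
have ivn : P.-integrable setT (fun x => (vn (W x))%:E).
  apply: le_integrable iv => //.
    by apply/measurable_EFinP; exact: (measurableT_comp mvn).
  move=> x _; rewrite lee_fin ger0_norm// /vn.
  by rewrite ge_max normr_ge0 -normrN ler_norm.
rewrite [RHS](_ : _ = \int[P]_x (vp (W x) - vn (W x))); last first.
  by apply: eq_Rintegral => x _.
rewrite RintegralB// [LHS](_ : _ = \int[mu]_x (vp x * f x - vn x * f x)); last first.
  by apply: eq_Rintegral => x _; rewrite -mulrBl -vpn.
rewrite RintegralB//; [|exact: integrable_density..].
by rewrite /Rintegral !ge0_integral_density.
Qed.

End density.

(** * Strict positivity of integrals, and dilations of the Lebesgue measure *)

Section lebesgue.
Context {R : realType}.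
Local Notation mu := (@lebesgue_measure R).

(** If the integral were 0, [f] would vanish outside a null set, and this set would contain ]u, v[,
    of measure v - u > 0. *)
Lemma ge0_Rintegral_gt0 (f : R -> R) (u v : R) : u < v ->
  mu.-integrable setT (EFin \o f) -> (forall x, 0 <= f x) ->
  (forall x, u < x -> x < v -> 0 < f x) -> 0 < \int[mu]_x f x.
Proof.
move=> uv intf f0 fuv; rewrite lt_neqAle Rintegral_ge0// andbT eq_sym.
apply/negP => /eqP If0.
have mf := measurable_int _ intf.
have : (\int[mu]_x `|(f x)%:E| = 0)%E.
  under eq_integral do rewrite gee0_abs ?lee_fin//.
  by rewrite -(fineK (integrable_fin_num measurableT intf)) [fine _]If0.
move=> /(ae_eq_integral_abs mu measurableT mf) [N [mN N0 fN]].
have : (mu `]u, v[%classic <= mu N)%E.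
  apply: le_measure; rewrite ?inE//.
  move=> x /=; rewrite in_itv/= => /andP[ux xv]; apply: fN => /= /(_ I).
  by move=> [fx0]; have := fuv _ ux xv; rewrite fx0 ltxx.
rewrite N0 lebesgue_measure_itv/= lte_fin uv -EFinB lee_fin; lra.
Qed.

Section scaling.
Variable k : R.
Hypothesis k0 : 0 < k.

Let scale (x : measurableTypeR R) : measurableTypeR R := k * x.
Let mscale_fun : measurable_fun setT scale.
Proof. exact: measurable_funM. Qed.
Let kn : {nonneg R} := NngNum (ltW k0).

(** Closed with [Defined] so that it unfolds to the measure of a preimage in the computation
    below. *)
Let pushed : {measure set (measurableTypeR R) -> \bar R}.
Proof. by unshelve refine (pushforward mu scale); exact: mscale_fun. Defined.

(** By uniqueness of the Lebesgue measure it suffices to test ]a, b]: its preimage ]a/k, b/k] has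
    length (b - a)/k, and the factor [k] restores b - a. *)
Let lebesgue_scale (A : set (measurableTypeR R)) : measurable A ->
  mu A = mscale kn pushed A.
Proof.
apply: lebesgue_measure_unique => _ [[a b]] _ <-.
rewrite -[RHS]/(k%:E * mu (scale @^-1` `]a, b]%classic))%E.
have -> : scale @^-1` `]a, b]%classic = `](a / k), (b / k)]%classic.
  apply/seteqP; split=> x/=; rewrite !in_itv/= /scale ltr_pdivrMr// ler_pdivlMr//;
  by rewrite mulrC.
rewrite !lebesgue_measure_itv/= !lte_fin ltr_pM2r ?invr_gt0//.
case: ifPn => _; last by rewrite mule0.
by rewrite -!EFinB -EFinM -mulrBl mulrCA divff ?mulr1// gt_eqF.
Qed.

Lemma ge0_integral_scale (f : R -> R) : measurable_fun setT f ->
  (forall x, 0 <= f x) ->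
  (\int[mu]_x (f (k * x))%:E = k^-1%:E * \int[mu]_x (f x)%:E)%E.
Proof.
move=> mf f0.
have -> : (\int[mu]_x (f x)%:E =
           \int[mscale kn pushed]_x (f x)%:E)%E.
  by apply: eq_measure_integral => A mA _; exact: lebesgue_scale.
rewrite ge0_integral_mscale//; last first.
- by move=> x _; rewrite lee_fin.
- exact/measurable_EFinP.
rewrite muleA -EFinM mulVf ?gt_eqF// mul1e ge0_integral_pushforward//.
- exact/measurable_EFinP.
- by move=> x _; rewrite lee_fin.
Qed.

Lemma integrable_scale (f : R -> R) : mu.-integrable setT (EFin \o f) ->
  mu.-integrable setT (fun x => (f (k * x))%:E).
Proof.
move=> /integrableP[/measurable_EFinP mf fy]; apply/integrableP; split.
  apply/measurable_EFinP; apply: (measurableT_comp mf).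
  exact: measurable_funM.
rewrite (@ge0_integral_scale (fun x => `|f x|))//.
  by rewrite lte_mul_pinfty// ?lee_fin ?invr_ge0 ?ltW.
exact: measurableT_comp.
Qed.

Lemma Rintegral_scale (f : R -> R) : mu.-integrable setT (EFin \o f) ->
  \int[mu]_x f (k * x) = k^-1 * \int[mu]_x f x.
Proof.
move=> intf; have mf : measurable_fun setT f.
  by have /measurable_int /measurable_EFinP := intf.
pose fp x := Num.max (f x) 0; pose fn x := Num.max (- f x) 0.
have mfp : measurable_fun setT fp by exact: measurable_funrpos.
have mfn : measurable_fun setT fn by exact: measurable_funrneg.
have fpn x : f x = fp x - fn x.
  by rewrite /fp /fn; case: (leP (f x) 0); case: (leP (- f x) 0); lra.
have fp0 x : 0 <= fp x by rewrite le_max lexx orbT.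
have fn0 x : 0 <= fn x by rewrite le_max lexx orbT.
have ifp : mu.-integrable setT (EFin \o fp).
  apply: le_integrable intf => //; first exact/measurable_EFinP.
  move=> x _; rewrite lee_fin ger0_norm// /fp.
  by rewrite ge_max normr_ge0 ler_norm.
have ifn : mu.-integrable setT (EFin \o fn).
  apply: le_integrable intf => //; first exact/measurable_EFinP.
  move=> x _; rewrite lee_fin ger0_norm// /fn.
  by rewrite ge_max normr_ge0 -normrN ler_norm.
rewrite [LHS](_ : _ = \int[mu]_x (fp (k * x) - fn (k * x))); last first.
  by apply: eq_Rintegral => x _.
rewrite RintegralB//; [|exact: integrable_scale..].
rewrite [X in _ = _ * X](_ : _ = \int[mu]_x (fp x - fn x)); last first.
  by apply: eq_Rintegral => x _.
rewrite RintegralB// mulrBr /Rintegral !ge0_integral_scale//.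
by rewrite !fineM// integrable_fin_num.
Qed.

End scaling.
End lebesgue.

(** * The potential phi *)

(** Near an interior point small increments stay in [I], so the relative difference quotient is
    eventually the ordinary one. *)
Lemma is_derive_within (R : realType) (I : set R) (f : R -> R) (x : R) :
  nbhs x I -> derivable_within I f x ->
  is_derive x (1 : R) f (derive_within I f x).
Proof.
move=> xI df; set l := derive_within I f x.
have H : h^-1 *: (f (h *: 1 + x) - f x) @[h --> (0:R)^'] --> l.
  apply/cvgrPdist_lt => e e0.
  have /cvgrPdist_lt/(_ e e0) : quot_within f x y @[y --> within I x^'] --> l.
    exact: df.
  move=> /nbhs_ballP[r /= r0 rI].
  move: xI => /nbhs_ballP[s /= s0 sI].
  apply/nbhs_ballP; exists (Num.min r s) => /=; first by rewrite lt_min r0.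
  move=> h /=; rewrite /ball/= sub0r normrN lt_min => /andP[hr hs] h0.
  have := rI (h + x); rewrite /ball/= opprD addrCA subrr addr0 normrN.
  move=> /(_ hr); rewrite -subr_eq0 addrK => /(_ h0).
  have hI : I (h + x).
    by apply: sI; rewrite /ball/= opprD addrCA subrr addr0 normrN.
  move=> /(_ hI); rewrite /quot_within addrK.
  by rewrite [h *: 1]mulr1 mulrC.
apply: DeriveDef; first by apply/cvg_ex; exists l.
exact: cvg_lim H.
Qed.

Lemma MVT_is_derive (R : realType) (f df : R -> R) (u v : R) : u < v ->
  (forall x, u <= x -> x <= v -> is_derive x (1 : R) f (df x)) ->
  exists x, [/\ u < x, x < v & f v - f u = df x * (v - u)].
Proof.
move=> uv dfx.
have [x||x xuv fuv] := @MVT R f df u v uv.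
- by rewrite in_itv/= => /andP[ux xv]; apply: dfx; exact: ltW.
- apply: derivable_within_continuous => x; rewrite in_itv/= => /andP[ux xv].
  by have ? := dfx x ux xv; exact: ex_derive.
- by exists x; move: xuv; rewrite in_itv/= => /andP[].
Qed.

Section potential.
Context {R : realType} (b : R) (c : \bar R) (phi dphi : R -> R).
Hypothesis b0 : 0 <= b.
Hypothesis phiD : forall w, b < w -> (w%:E < c)%E ->
  is_derive w (1 : R) phi (dphi w).
Hypothesis dphi_nd : forall v w, b < v -> v <= w -> (w%:E < c)%E ->
  v * dphi v <= w * dphi w.

(** Convexity of [phi] in the variable ln w, in the form of increments: x times the derivative of
    phi(kx) - phi(x) is kx phi'(kx) - x phi'(x) >= 0. *)
Lemma dilation_increment_nd (k v w : R) : 1 <= k -> b < v -> v <= w ->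
  ((k * w)%:E < c)%E -> phi (k * v) - phi v <= phi (k * w) - phi w.
Proof.
move=> k1 bv; rewrite le_eqVlt => /predU1P[->//|vw] kwc.
have k0 : 0 < k by lra.
pose dpsi x := k * dphi (k * x) - dphi x.
have [|x [vx xw]] := @MVT_is_derive _ (fun x => phi (k * x) - phi x) dpsi _ _ vw.
  move=> x vx xw.
  have x0 : 0 < x by have := b0; lra.
  have xkx : x <= k * x by rewrite ler_peMl// ltW.
  have kxc : ((k * x)%:E < c)%E.
    by apply: le_lt_trans kwc; rewrite lee_fin ler_pM2l.
  have xc : (x%:E < c)%E by apply: le_lt_trans kxc; rewrite lee_fin.
  have bx : b < x by lra.
  have dk : is_derive x (1 : R) (fun x => k * x) k.
    apply: (is_derive_eq (is_deriveM (is_derive_cst _ _ _) (is_derive_id _ _))).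
    by rewrite scaler0 addr0 /GRing.scale/= mulr1.
  have dphik := phiD (lt_le_trans bx xkx) kxc.
  have d1 := @is_derive1_comp _ phi (fun x => k * x) _ _ _ dphik dk.
  have d2 := phiD bx xc.
  by apply: is_derive_eq (is_deriveB d1 d2) _; rewrite /dpsi mulrC.
move=> eq; rewrite -subr_ge0 eq mulr_ge0//; last by rewrite subr_ge0 ltW.
have x0 : 0 < x by have := b0; lra.
rewrite -(pmulr_rge0 _ x0) /dpsi mulrBr mulrCA mulrA subr_ge0.
apply: dphi_nd; [lra|by rewrite ler_peMl// ltW|].
by apply: le_lt_trans kwc; rewrite lee_fin ler_pM2l// ltW.
Qed.

Hypothesis cy : c = +oo%E.
Hypothesis dphi_y : w * dphi w @[w --> +oo] --> +oo.

Let dphi_large (K : R) : exists M, [/\ b < M, 0 < M &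
  forall w, M < w -> K < w * dphi w].
Proof.
have /cvgryPgt/(_ K) [M [_ MK]] := dphi_y.
exists (Num.max M (b + 1)); have := b0 => b0'; split.
- by rewrite lt_max; apply/orP; right; lra.
- by rewrite lt_max; apply/orP; right; lra.
- by move=> w; rewrite gt_max => /andP[Mw _]; exact: MK.
Qed.

(** By the mean value theorem the increment is phi'(x) (k - 1) w with w < x < kw. As w > x/k, it
    exceeds x phi'(x) (k - 1)/k, which is large with x. *)
Lemma dilation_increment_large (k K : R) : 1 < k ->
  exists M, forall w, M < w -> K < phi (k * w) - phi w.
Proof.
move=> k1; have k0 : 0 < k by lra.
have k10 : 0 < k - 1 by lra.
(* The threshold compensates the factor (k - 1)/k; the absolute value keeps it nonnegative, so that
   phi'(x) > 0. *)
have [M [bM M0 HM]] := dphi_large (`|K| * k / (k - 1)).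
exists M => w Mw; have w0 : 0 < w by lra.
have wkw : w < k * w by rewrite ltr_pMl.
have [|x [wx xkw ->]] := @MVT_is_derive _ phi dphi _ _ wkw.
  by move=> x wx _; apply: phiD; [lra|rewrite cy ltry].
have x0 : 0 < x by lra.
have := HM x (lt_trans Mw wx).
rewrite ltr_pdivrMr// => H.
have d0 : 0 < dphi x.
  rewrite -(pmulr_rgt0 _ x0); apply: le_lt_trans (HM x (lt_trans Mw wx)).
  by rewrite divr_ge0 ?mulr_ge0// ltW.
have Kn := ler_norm K.
have d1 : 0 < dphi x * (k - 1) by rewrite mulr_gt0.
have : `|K| * k < dphi x * (k - 1) * (k * w).
  apply: lt_le_trans H _.
  have -> : x * dphi x * (k - 1) = dphi x * (k - 1) * x by ring.
  by rewrite ler_pM2l// ltW.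
move=> H2; apply: le_lt_trans Kn _; rewrite -(ltr_pM2r k0); apply: lt_le_trans H2 _.
by rewrite le_eqVlt; apply/orP; left; apply/eqP; ring.
Qed.

(** phi - N ln is nondecreasing once x phi'(x) > N. Hence e^(-phi) decays faster than any power. *)
Lemma potential_ge_ln (N : R) : exists M C,
  [/\ b < M, 0 < M & forall w, M < w -> N * ln w + C <= phi w].
Proof.
have [M [bM M0 HM]] := dphi_large N.
exists (M + 1), (phi (M + 1) - N * ln (M + 1)); split; [lra|lra|move=> w Mw].
have [|x [wx xkw]] := @MVT_is_derive _ (fun x => phi x - N * ln x)
   (fun x => dphi x - N * x^-1) _ _ Mw.
  move=> x Mx xw.
  have bx : b < x by lra.
  have x0 : 0 < x by lra.
  have dx : is_derive x (1 : R) phi (dphi x) by apply: phiD => //; rewrite cy ltry.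
  exact: is_deriveB dx (is_deriveZ N (is_derive1_ln x0)).
have x0 : 0 < x by lra.
have : 0 <= (dphi x - N / x) * (w - (M + 1)).
  rewrite mulr_ge0//; last lra.
  rewrite subr_ge0 ler_pdivrMr// mulrC; apply/ltW/HM; lra.
by move=> H E; move: H; rewrite -E; lra.
Qed.

End potential.

(** * Total positivity and the sign change *)

Section variation_diminishing.
Context {R : realType} (b : R) (c : \bar R) (C r : R) (phi dphi : R -> R).
Hypothesis b0 : 0 <= b.
Hypothesis bc : (b%:E < c)%E.
Hypothesis C0 : 0 < C.
Hypothesis phiD : forall w, b < w -> (w%:E < c)%E ->
  is_derive w (1 : R) phi (dphi w).
Hypothesis dphi_nd : forall v w, b < v -> v <= w -> (w%:E < c)%E ->
  v * dphi v <= w * dphi w.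
Hypothesis dphi_y : c = +oo%E -> w * dphi w @[w --> +oo] --> +oo.
Local Notation mu := (@lebesgue_measure R).

(** The end point [b] is left out, so that w > 0 and [phi] has a two-sided derivative at every such
    point. *)
Definition inside (w : R) : bool := (b < w) && (w%:E < c)%E.

(* For r = p + 3 this is w^3 times the density of W, except at the null point b. *)
Definition weight (w : R) : R :=
  if inside w then C * w `^ r * expR (- phi w) else 0.

Hypothesis int_weight : mu.-integrable setT (EFin \o weight).

Lemma weight_gt0 (w : R) : inside w -> 0 < weight w.
Proof.
move=> wI; rewrite /weight wI; have /andP[bw _] := wI.
by rewrite !mulr_gt0 ?expR_gt0 ?powR_gt0// (le_lt_trans b0).
Qed.

Lemma weight_ge0 (w : R) : 0 <= weight w.
Proof.
have [wI|/negbTE wI] := boolP (inside w); first exact/ltW/weight_gt0.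
by rewrite /weight wI.
Qed.

Lemma interval_inside : exists u v, u < v /\
  forall w, u < w -> w < v -> inside w.
Proof.
move: bc; rewrite /inside; case: c => [c'|_|//]; last first.
  by exists b, (b + 1); split => [|w ->]; [lra|rewrite ltry].
rewrite lte_fin => bc'; exists b, c'; split => // w -> wc.
by rewrite lte_fin.
Qed.

(** The powers contribute (kv)^r w^r to both sides, so only the dilation increments of [phi]
    remain. *)
Let weightM (k v w : R) : 0 < k -> 0 < v -> 0 < w ->
  (C * (k * w) `^ r * expR (- phi (k * w))) * (C * v `^ r * expR (- phi v)) =
  (C * (k * v) `^ r * expR (- phi (k * v))) * (C * w `^ r * expR (- phi w)) *
  expR ((phi (k * v) - phi v) - (phi (k * w) - phi w)).
Proof.
move=> k0 v0 w0; rewrite !powRM ?ltW//.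
have -> : phi (k * v) - phi v - (phi (k * w) - phi w) =
  phi (k * v) + (- phi v + (- phi (k * w) + phi w)) by ring.
have e1 x : expR x != 0 by rewrite gt_eqF ?expR_gt0.
by rewrite !expRD !expRN; field; rewrite !e1.
Qed.

Lemma inside_le (u v w : R) : inside u -> inside w -> u <= v -> v <= w ->
  inside v.
Proof.
move=> /andP[bu _] /andP[_ wc] uv vw; apply/andP; split.
  exact: lt_le_trans uv.
by apply: le_lt_trans wc; rewrite lee_fin.
Qed.

(* Log-concavity of the weight in the variable ln w. *)
Lemma weight_TP2 (k v w : R) : 1 <= k -> v <= w ->
  weight (k * w) * weight v <= weight (k * v) * weight w.
Proof.
move=> k1 vw; have k0 : 0 < k by lra.
have [kwI|/negbTE kwI] := boolP (inside (k * w)); last first.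
  by rewrite {1}/weight kwI mul0r mulr_ge0 ?weight_ge0.
have [vI|/negbTE vI] := boolP (inside v); last first.
  by rewrite {2}/weight vI mulr0 mulr_ge0 ?weight_ge0.
have v0 : 0 < v by have /andP[? _] := vI; exact: le_lt_trans b0 _.
have w0 : 0 < w by lra.
have wI : inside w by apply: (inside_le vI kwI) => //; rewrite ler_peMl// ltW.
have kvI : inside (k * v).
  by apply: (inside_le vI kwI); rewrite ?ler_peMl ?ler_pM2l// ltW.
rewrite /weight kwI vI wI kvI weightM// ler_piMr//.
  by rewrite !mulr_ge0 ?expR_ge0 ?powR_ge0// ltW.
rewrite -expR0 ler_expR subr_le0.
have /andP[bv _] := vI; have /andP[_ kwc] := kwI.
exact: (dilation_increment_nd b0 phiD dphi_nd).
Qed.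

(** Strictness on some interval is enough to make an integral strictly positive. For finite [c] it
    comes from the cut-off at [c]; for infinite [c], from the unbounded growth of the dilation
    increments. *)
Lemma weight_TP2_strict (k v : R) : 1 < k -> inside v -> inside (k * v) ->
  exists u1 u2, [/\ u1 < u2, v <= u1 & forall w, u1 < w -> w < u2 ->
    weight (k * w) * weight v < weight (k * v) * weight w].
Proof.
move=> k1 vI kvI; have k0 : 0 < k by lra.
have /andP[bv vc] := vI; have v0 : 0 < v by exact: le_lt_trans bv.
have [cE|cfin] := eqVneq c +oo%E; last first.
  have /fineK cE : c \is a fin_num.
    by rewrite fin_numE cfin andbT gt_eqF// (le_lt_trans (leNye b%:E)).
  set c' := fine c in cE.
  have kvc : k * v < c' by have /andP[_] := kvI; rewrite -cE lte_fin.
  have v1 : v < c' / k by rewrite ltr_pdivlMr// mulrC.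
  have c1 : c' / k < c'.
    rewrite ltr_pdivrMr// ltr_pMr//.
    by apply: lt_trans v0 _; move: vc; rewrite -cE lte_fin.
  (* Between c'/k and c' the point k w has left the support while w has not, so the left side is 0
     and the right side positive. *)
  exists (c' / k), c'; split => [//||w cw wc]; first exact: ltW.
  rewrite {1}/weight /inside -cE lte_fin [k * w < c']ltNge.
  rewrite [c' <= k * w]ltW ?andbF ?mul0r; last by rewrite mulrC -ltr_pdivrMr.
  rewrite mulr_gt0 ?weight_gt0// /inside -cE lte_fin wc andbT; lra.
have [M HM] := @dilation_increment_large _ b c phi dphi b0 phiD cE (dphi_y cE) k
   (phi (k * v) - phi v) k1.
exists (Num.max v M), (Num.max v M + 1); split; [lra|by rewrite le_max lexx|].
move=> w; rewrite gt_max => /andP[vw Mw] _.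
have w0 : 0 < w by lra.
have bw : b < w by lra.
have wI : inside w by rewrite /inside bw cE ltry.
have kwI : inside (k * w).
  by rewrite /inside cE ltry andbT (lt_le_trans bw)// ler_peMl// ltW.
rewrite /weight kwI vI wI kvI weightM// gtr_pMr//; last first.
  have kv0 : 0 < k * v by rewrite mulr_gt0.
  by rewrite !(mulr_gt0, expR_gt0, powR_gt0).
by rewrite -expR0 ltr_expR subr_lt0; exact: HM.
Qed.

Variables (x0 K : R) (k : R -> R).
Hypothesis x00 : 0 < x0.
Hypothesis k_gt0 : forall x, x < x0 -> 0 < k x.
Hypothesis k_lt0 : forall x, x0 < x -> k x < 0.
Hypothesis k_cont : continuous k.
Hypothesis k_bound : forall x, `|k x| <= K.

Definition kernel_integral (t : R) : R := \int[mu]_w (weight w * k (t * w)).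

Let integrable_wk (t : R) :
  mu.-integrable setT (EFin \o (fun w => weight w * k (t * w))).
Proof.
have K0 : 0 <= K by exact: le_trans (k_bound 0).
have /measurable_int /measurable_EFinP mw := int_weight.
apply: (@le_integrable _ _ _ mu _ measurableT _
  (fun w => (K * weight w)%:E)).
- apply/measurable_EFinP/measurable_funM => //.
  apply: (measurableT_comp (continuous_measurable_fun k_cont)).
  exact: measurable_funM.
- move=> x _; rewrite /= lee_fin [leRHS]ger0_norm ?mulr_ge0 ?weight_ge0//.
  by rewrite normrM mulrC (ger0_norm (weight_ge0 x)) ler_wpM2r ?weight_ge0.
- by under eq_fun do rewrite EFinM; exact: integrableZl.
Qed.

Lemma kernel_integral_gt0 (t : R) : (forall w, inside w -> 0 < k (t * w)) ->
  0 < kernel_integral t.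
Proof.
move=> kt; have [u [v [uv uvI]]] := interval_inside.
apply: (ge0_Rintegral_gt0 uv) => [|w|w uw wv]; first exact: integrable_wk.
  have [wI|/negbTE wI] := boolP (inside w).
    by rewrite mulr_ge0 ?weight_ge0// ltW// kt.
  by rewrite /weight wI mul0r.
by rewrite mulr_gt0 ?weight_gt0 ?kt ?uvI.
Qed.

Lemma kernel_integral_lt0 (t : R) : (forall w, inside w -> k (t * w) < 0) ->
  kernel_integral t < 0.
Proof.
move=> kt; have [u [v [uv uvI]]] := interval_inside.
have ikt := integrable_wk t.
have iNkt : mu.-integrable setT (EFin \o (fun w => -1 * (weight w * k (t * w)))).
  by rewrite /comp; under eq_fun do rewrite EFinM; exact: integrableZl.
suff : 0 < \int[mu]_w (-1 * (weight w * k (t * w))).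
  by rewrite RintegralZl// mulN1r oppr_gt0.
apply: (ge0_Rintegral_gt0 uv) => [//|w|w uw wv].
  have [wI|/negbTE wI] := boolP (inside w).
    by rewrite mulN1r -mulrN mulr_ge0 ?weight_ge0// oppr_ge0 ltW// kt.
  by rewrite /weight wI mul0r mulr0.
by rewrite mulN1r -mulrN mulr_gt0 ?weight_gt0 ?uvI// oppr_gt0 kt ?uvI.
Qed.

(** With l = t2/t1 and v = x0/t2, the difference [H] of the two integrands, each taken with a
    constant weight, factors into two terms that change sign together at w = l v. Its integral is
    thus positive, which gives weight(l v) l I(t2) < weight(v) I(t1) <= 0, where I is
    [kernel_integral]. *)
Lemma kernel_integral_crossing (t1 t2 : R) : 0 < t1 -> t1 < t2 ->
  kernel_integral t1 <= 0 -> kernel_integral t2 < 0.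
Proof.
move=> t10 t12 I1; have t20 : 0 < t2 by lra.
(* Here t2 w lies beyond [x0] on the whole support. *)
have [x0b|bx0] := leP (x0 / t2) b.
  apply: kernel_integral_lt0 => w /andP[bw _]; apply: k_lt0.
  by rewrite mulrC -ltr_pdivrMr// (le_lt_trans x0b).
(* Here t1 w stays below [x0] on the whole support, contradicting [I1]. Otherwise v and l v both lie
   in the support and have positive weight. *)
have [cx0|x0c] := leP c (x0 / t1)%:E.
  have : 0 < kernel_integral t1.
    apply: kernel_integral_gt0 => w /andP[_ wc]; apply: k_gt0.
    by rewrite mulrC -ltr_pdivlMr// -lte_fin (lt_le_trans wc).
  by move=> ?; exfalso; lra.
pose l := t2 / t1; have l1 : 1 < l by rewrite ltr_pdivlMr ?mul1r.
have l0 : 0 < l by lra.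
set v := x0 / t2 in bx0.
have lv : l * v = x0 / t1 by rewrite /l /v; field; rewrite !gt_eqF.
have v0 : 0 < v by rewrite divr_gt0.
have vlv : v <= l * v by rewrite ler_peMl // ltW.
have lvI : inside (l * v) by rewrite /inside lv x0c andbT -lv (lt_le_trans bx0).
have vI : inside v.
  by rewrite /inside bx0 (le_lt_trans _ x0c)// lee_fin -lv.
have [u1 [u2 [u12 vu1 Hu]]] := weight_TP2_strict l1 vI lvI.
pose H w := weight v * (weight w * k (t1 * w)) -
  weight (l * v) * (weight (l^-1 * w) * k (t2 * (l^-1 * w))).
have tl w : t2 * (l^-1 * w) = t1 * w by rewrite /l; field; rewrite !gt_eqF.
have HE w : H w = (weight (l * v) * weight (l^-1 * w) - weight v * weight w) *
    - k (t1 * w) by rewrite /H tl; ring.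
have i1 : mu.-integrable setT (EFin \o (fun w => weight v * (weight w * k (t1 * w)))).
  rewrite /comp; under eq_fun do rewrite EFinM.
  apply: integrableZl => //; exact: integrable_wk.
have li0 : 0 < l^-1 by rewrite invr_gt0.
have i2' : mu.-integrable setT
    (EFin \o (fun w => weight (l^-1 * w) * k (t2 * (l^-1 * w)))).
  exact: (integrable_scale li0 (integrable_wk t2)).
have i2 : mu.-integrable setT (EFin \o (fun w =>
    weight (l * v) * (weight (l^-1 * w) * k (t2 * (l^-1 * w))))).
  by rewrite /comp; under eq_fun do rewrite EFinM; exact: integrableZl.
have iH : mu.-integrable setT (EFin \o H).
  by rewrite /comp /H; under eq_fun do rewrite EFinB; exact: integrableB.
have lu12 : l * u1 < l * u2 by rewrite ltr_pM2l.
have : 0 < \int[mu]_w H w.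
  apply: (ge0_Rintegral_gt0 lu12 iH) => [w|w uw wu]; rewrite HE.
    have [wx|xw|->] := ltgtP w (l * v); last first.
    (* At w = l v the first factor vanishes, whatever the value of [k] at [x0]. *)
    - by rewrite mulKf ?gt_eqF// [weight v * _]mulrC subrr mul0r.
    - apply: mulr_ge0; last first.
        by rewrite oppr_ge0 ltW// k_lt0// mulrC -ltr_pdivrMr// -lv.
      rewrite subr_ge0 mulrC.
      have := @weight_TP2 l v (l^-1 * w) (ltW l1).
      rewrite mulVKf ?gt_eqF//; apply.
      by rewrite mulrC ler_pdivlMr// mulrC ltW.
    - rewrite -mulrNN opprK opprB; apply: mulr_ge0; last first.
        by rewrite ltW// k_gt0// mulrC -ltr_pdivlMr// -lv.
      rewrite subr_ge0 [leRHS]mulrC.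
      have := @weight_TP2 l (l^-1 * w) v (ltW l1).
      rewrite mulVKf ?gt_eqF//; apply.
      by rewrite mulrC ler_pdivrMr// mulrC ltW.
  have lvw : l * v < w by rewrite (le_lt_trans _ uw)// ler_pM2l.
  apply: mulr_gt0; last first.
    by rewrite oppr_gt0 k_lt0// mulrC -ltr_pdivrMr// -lv.
  rewrite subr_gt0 mulrC.
  have := Hu (l^-1 * w); rewrite mulVKf ?gt_eqF//; apply.
    by rewrite mulrC ltr_pdivlMr// mulrC.
  by rewrite mulrC ltr_pdivrMr// mulrC.
rewrite /H RintegralB// !RintegralZl//.
(* The substitution turns the second integral into l I(t2). *)
rewrite (@Rintegral_scale _ _ li0 (fun w => weight w * k (t2 * w)))//.
rewrite -!/(kernel_integral _) invrK subr_gt0 => H0.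
have : weight (l * v) * (l * kernel_integral t2) < 0.
  by apply: lt_le_trans H0 _; rewrite mulr_ge0_le0 ?weight_ge0.
by rewrite pmulr_rlt0 ?weight_gt0// pmulr_rlt0.
Qed.

End variation_diminishing.

(** * Real-variable arguments for a single sign change *)

Lemma exists_nonpos_derivative2 (R : realType) (F F1 F2 : R -> R) (M : R) :
  (forall t : R, 0 < t -> is_derive t (1 : R) F (F1 t)) ->
  (forall t : R, 0 < t -> is_derive t (1 : R) F1 (F2 t)) ->
  (forall t : R, 0 < t -> `|F t| <= M) -> 0 < F1 1 ->
  exists t : R, 0 < t /\ F2 t <= 0.
Proof.
move=> dF dF1 FM F11; apply: contrapT => noF2.
have F2p t : 0 < t -> 0 < F2 t.
  by move=> t0; rewrite ltNge; apply/negP => F2t; apply: noF2; exists t.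
have F1_ge t : 1 < t -> F1 1 <= F1 t.
  move=> t1; have [|x [x1 xt E]] := @MVT_is_derive _ F1 F2 _ _ t1.
    by move=> x x1 _; apply: dF1; lra.
  rewrite -subr_ge0 E mulr_ge0//; last lra.
  by rewrite ltW// F2p//; lra.
have M0 : 0 <= M by exact: le_trans (FM 1 ltr01).
(* A slope of at least [F1 1] over this length produces an increase of 2M + 1, more than the
   oscillation 2M that the bound on [F] allows. *)
pose t := 1 + (2 * M + 1) / F1 1.
have t1 : 1 < t by rewrite /t ltrDl divr_gt0//; lra.
have [|x [x1 xt E]] := @MVT_is_derive _ F F1 _ _ t1.
  by move=> x x1 _; apply: dF; lra.
have : 2 * M + 1 <= F t - F 1.
  rewrite E; have := F1_ge _ x1; rewrite -(@ler_pM2r _ (t - 1)); last lra.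
  apply: le_trans; rewrite /t addrAC subrr add0r [leRHS]mulrC divfK// gt_eqF//.
have := FM t; have := FM 1 ltr01; rewrite !ler_norml => /andP[? ?].
have t0 : 0 < t by lra.
by move=> /(_ t0)/andP[? ?]; lra.
Qed.

(** The crossing point is the infimum of the points where [g] is nonpositive: any s beyond it has
    such a point before it, so [g s] is negative. *)
Lemma single_crossing (R : realType) (g : R -> R) :
  (exists d : R, 0 < d /\ forall t : R, 0 < t -> t < d -> 0 < g t) ->
  (exists t : R, 0 < t /\ g t <= 0) ->
  (forall t1 t2 : R, 0 < t1 -> t1 < t2 -> g t1 <= 0 -> g t2 < 0) ->
  first_positive_then_negative g.
Proof.
move=> [d [d0 gd]] [t [t0 gt]] gcross.
pose S := [set t | 0 < t /\ g t <= 0].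
have Sd : lbound S d.
  move=> s [s0 gs]; rewrite leNgt; apply/negP => sd.
  by have := gd s s0 sd; rewrite ltNge gs.
have Si : has_inf S by split; [exists t|exists d].
exists (inf S); split.
- by apply: lt_le_trans d0 _; apply: lb_le_inf => //; exists t.
- move=> s s0 sS; rewrite ltNge; apply/negP => gs.
  by have := @ge_inf _ S (proj2 Si) s (conj s0 gs); rewrite leNgt sS.
- move=> s /(inf_lt (proj1 Si))[u [u0 gu] us].
  exact: gcross u0 us gu.
Qed.

(** * The third moment and the passage to Lebesgue integrals *)

Lemma inside_nbhs (R : realType) (b : R) (c : \bar R) (w : R) :
  inside b c w -> nbhs w (itv_cc b c).
Proof.
move=> /andP[bw wc].
case: c wc => [c wc|_|//].
  near=> x; split; [near: x|rewrite lee_fin; near: x].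
    by apply: filterS (lt_nbhsr bw) => x /ltW.
  by apply: filterS (lt_nbhsl (wc : w < c)) => x /ltW.
near=> x; split; [near: x|by rewrite leey].
by apply: filterS (lt_nbhsr bw) => x /ltW.
Unshelve. all: by end_near. Qed.

Section potts.
Context {R : realType} {d : measure_display} {T : measurableType d}.
Variables (P : probability T R) (W : {RV P >-> R}).
Variables (C p : R) (phi dphi : R -> R) (b : R) (c : \bar R).
Hypothesis b0 : 0 <= b.
Hypothesis bc : (b%:E < c)%E.
Hypothesis C_ge0 : 0 <= C.
Hypothesis Wdens : has_density W (weight_density C p phi b c).
Hypothesis phiD : forall w, b < w -> (w%:E < c)%E ->
  is_derive w (1 : R) phi (dphi w).
Hypothesis dphi_nd : forall v w, b < v -> v <= w -> (w%:E < c)%E ->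
  v * dphi v <= w * dphi w.
Hypothesis dphi_y : c = +oo%E -> w * dphi w @[w --> +oo] --> +oo.
Local Notation mu := (@lebesgue_measure R).
Local Notation wd := (weight_density C p phi b c).
Local Notation weight := (weight b c C (p + 3%:R) phi).

Let wd_ge0 w : 0 <= wd w. Proof. by case: Wdens. Qed.
Let measurable_wd : measurable_fun setT wd. Proof. by case: Wdens. Qed.

Let int_wd : (\int[mu]_w (wd w)%:E = 1)%E.
Proof.
transitivity (\int[P]_x (cst 1 (W x))%:E)%E; last first.
  rewrite -[LHS]/(\int[P]_(x in setT) cst 1%E x)%E integral_cst//.
  by rewrite mul1e; exact: probability_setT.
rewrite -(ge0_integral_density Wdens) => [||w]; [|exact: measurable_cst|exact: ler01].
by apply: eq_integral => w _; rewrite mul1r.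
Qed.

(** With [C = 0] the density would vanish, while its total mass is 1. *)
Lemma weight_density_scale_gt0 : 0 < C.
Proof.
rewrite lt_neqAle C_ge0 andbT eq_sym; apply/eqP => CE.
have := int_wd; rewrite integral0_eq; last first.
  by move=> w _; rewrite /weight_density CE !mul0r.
by move=> /eqP; rewrite eqe eq_sym oner_eq0.
Qed.

Let C_gt0 := weight_density_scale_gt0.

Let wd_out w : ~ itv_co b c w -> wd w = 0.
Proof. by move=> wI; rewrite /weight_density indicE memNset// mulr0. Qed.

Let wd_in w : itv_co b c w -> wd w = C * w `^ p * expR (- phi w).
Proof. by move=> wI; rewrite /weight_density indicE mem_set// mulr1. Qed.

(** The indicator removes [b], which belongs to the support of the density but not to [inside]. *)
Let weightE w : weight w = w ^+ 3 * wd w * \1_(~` [set b]) w.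
Proof.
rewrite /weight; case: ifPn => [/andP[bw wc]|wI].
  have w0 : 0 < w by exact: le_lt_trans bw.
  rewrite wd_in; last by split => //; exact: ltW.
  rewrite indicE mem_set/=; last by move=> wb; rewrite wb ltxx in bw.
  rewrite powRD; last by rewrite (gt_eqF w0)/= implybT.
  by rewrite -powR_mulrn ?ltW//; ring.
have [->|wb] := eqVneq w b.
  by rewrite indicE memNset ?mulr0// => /(_ erefl).
rewrite wd_out ?mulr0 ?mul0r// => -[bw wc].
by move: wI; rewrite /inside wc andbT lt_neqAle bw eq_sym wb.
Qed.

(** An integrable comparison function, 1/(1 + w^2) on the half line, with integral pi/2. *)
Let quad : R -> R := (fun x => (oneDsqr x)^-1) \_ `[0, +oo[.

(* When c = +oo, [e^{-phi w}] is [O(w^{-(p+5)})], so that the tail of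
   [w^3 * wd w] is [O(w^{-2})]. *)
Let cube_wd_bound : exists A1 A2 : R, [/\ 0 <= A1, 0 <= A2 & forall w,
  `|w| ^+ 3 * wd w <= A1 * wd w + A2 * quad w].
Proof.
have q0 w : 0 <= quad w.
  by rewrite /quad patchE; case: ifPn => // _; rewrite invr_ge0.
have [cE|cfin] := eqVneq c +oo%E; last first.
  have /fineK cE : c \is a fin_num.
    by rewrite fin_numE cfin andbT gt_eqF// (le_lt_trans (leNye b%:E)).
  set c' := fine c in cE.
  have c'0 : 0 <= c'.
    by rewrite ltW// (le_lt_trans b0)// -lte_fin cE.
  exists (c' ^+ 3), 0; split => // [|w]; first exact: exprn_ge0.
  rewrite mul0r addr0.
  have [wI|wI] := pselect (itv_co b c w); last by rewrite wd_out ?mulr0.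
  have [bw wc] := wI.
  rewrite ler_wpM2r// lerXn2r ?nnegrE// ger0_norm ?(le_trans b0)//.
  by rewrite ltW// -lte_fin cE.
have [M [K [bM M0 HM]]] :=
  potential_ge_ln b0 phiD cE (dphi_y cE) (p + 5%:R).
(* Up to [M] the cube is at most M^3. Beyond it, w^3 times the density is at most C e^(-K) w^(-2),
   and w^(-2) <= (1 + M^(-2))/(1 + w^2) because w > M. *)
exists (M ^+ 3), (C * expR (- K) * (1 + M ^- 2)).
split; [by rewrite exprn_ge0 ?ltW| |move=> w].
  by rewrite !mulr_ge0 ?expR_ge0// addr_ge0// invr_ge0 exprn_ge0 ?ltW.
have [wI|wI] := pselect (itv_co b c w); last first.
  rewrite wd_out// !mulr0 add0r mulr_ge0//.
  by rewrite !mulr_ge0 ?expR_ge0// addr_ge0// invr_ge0 exprn_ge0 ?ltW.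
have [bw _] := wI; rewrite ger0_norm ?(le_trans b0)//.
have [wM|Mw] := leP w M.
  rewrite ler_wpDr//.
    by rewrite mulr_ge0// !mulr_ge0 ?expR_ge0// addr_ge0// invr_ge0 exprn_ge0 ?ltW.
  by rewrite ler_wpM2r// lerXn2r ?nnegrE ?(le_trans b0)// ltW.
have w0 : 0 < w by lra.
apply: ler_wpDl; first by rewrite mulr_ge0// exprn_ge0// ltW.
rewrite wd_in//.
rewrite /quad patchE mem_set/=; last by rewrite in_itv/= andbT ltW.
have e1 : expR (- phi w) <= expR (- K) * w `^ (- (p + 5%:R)).
  by rewrite /powR gt_eqF// -expRD ler_expR; have := HM _ Mw; lra.
have e2 : w `^ p * w `^ (- (p + 5%:R)) = w ^- 5.
  rewrite -powRD; last by rewrite (gt_eqF w0)/= implybT.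
  rewrite -powR_mulrn ?ltW// -powRN; congr (_ `^ _); ring.
have e3 : C * w `^ p * expR (- phi w) <= C * expR (- K) * w ^- 5.
  rewrite -mulrA -mulrA ler_pM2l// -e2 mulrCA ler_wpM2l ?powR_ge0//.
apply: (@le_trans _ _ (w ^+ 3 * (C * expR (- K) * w ^- 5))).
  by rewrite ler_pM2l ?exprn_gt0.
have -> : w ^+ 3 * (C * expR (- K) * w ^- 5) = C * expR (- K) * w ^- 2.
  by field; rewrite gt_eqF.
rewrite -[leRHS]mulrA ler_pM2l ?mulr_gt0 ?expR_gt0//.
rewrite -[(oneDsqr w)^-1]/((1 + w ^+ 2)^-1).
have w20 : 0 < 1 + w ^+ 2 by rewrite ltr_wpDr ?sqr_ge0.
rewrite ler_pdivlMr// mulrDr mulr1 mulVf ?expf_neq0 ?gt_eqF// addrC lerD2l.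
by rewrite lef_pV2 ?posrE ?exprn_gt0// lerXn2r ?nnegrE ?ltW.
Qed.

Lemma integrable_cube : P.-integrable setT (fun x => (`|W x| ^+ 3)%:E).
Proof.
have mW3 : measurable_fun setT (fun w : R => `|w| ^+ 3).
  by apply: measurable_funX; exact: normr_measurable.
apply/integrableP; split.
  apply/measurable_EFinP.
  exact: (measurableT_comp mW3 (measurable_funP W)).
under eq_integral => x _ do rewrite gee0_abs ?lee_fin ?exprn_ge0//.
rewrite -(ge0_integral_density Wdens mW3); last by move=> w; rewrite exprn_ge0.
have [A1 [A2 [A10 A20 HA]]] := cube_wd_bound.
have mq : measurable_fun setT quad.
  apply/(measurable_restrictT _ _).1 => //.
  by apply: measurable_funTS; apply: continuous_measurable_fun;
    exact: continuous_oneDsqrV.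
have q0 w : 0 <= quad w.
  by rewrite /quad patchE; case: ifPn => // _; rewrite invr_ge0.
apply: (@le_lt_trans _ _ (\int[mu]_w (A1%:E * (wd w)%:E +
    A2%:E * (quad w)%:E))%E).
  apply: ge0_le_integral => //.
  - by move=> w _; rewrite lee_fin mulr_ge0.
  - by apply/measurable_EFinP; exact: measurable_funM.
  - by apply: emeasurable_funD; apply: measurable_funeM; exact/measurable_EFinP.
  - by move=> w _; rewrite lee_fin HA.
rewrite ge0_integralD//; first last.
- by apply: measurable_funeM; exact/measurable_EFinP.
- by move=> w _; rewrite mule_ge0 ?lee_fin.
- by apply: measurable_funeM; exact/measurable_EFinP.
- by move=> w _; rewrite mule_ge0 ?lee_fin.
rewrite !ge0_integralZl//; 
  try exact/measurable_EFinP; try by move=> w _; rewrite lee_fin.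
rewrite int_wd mule1.
suff -> : (\int[mu]_x (quad x)%:E = (pi / 2)%:E)%E by rewrite -EFinM -EFinD ltry.
by rewrite -integral0y_oneDsqr [RHS]integral_mkcond restrict_EFin.
Qed.

Lemma integrable_weight : mu.-integrable setT (EFin \o weight).
Proof.
have ms : measurable_fun setT (\1_(~` [set b]) : R -> R).
  by apply: measurable_indic; exact: measurableC.
have -> : EFin \o weight = (fun w => (w ^+ 3 * wd w * \1_(~` [set b]) w)%:E).
  by apply/funext => w; rewrite /= weightE.
have i3 : mu.-integrable setT (fun w => (w ^+ 3 * wd w)%:E).
  apply: (integrable_density Wdens (v := fun w => w ^+ 3)).
    exact: measurable_funX.
  apply: le_integrable integrable_cube => //.
    apply/measurable_EFinP; apply: measurable_funX; exact: measurable_funP W.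
  by move=> x _; rewrite /= lee_fin normrX [leRHS]ger0_norm ?exprn_ge0.
apply: le_integrable i3 => //.
  apply/measurable_EFinP/measurable_funM => //.
  by apply: measurable_funM => //; exact: measurable_funX.
move=> w _; rewrite /= lee_fin normrM ler_piMr//.
by rewrite indicE; case: (_ \in _); rewrite /= ?normr1 ?normr0.
Qed.

Lemma Rintegral_cube_weight (k : R -> R) (K t : R) : continuous k ->
  (forall x, `|k x| <= K) ->
  \int[P]_x (W x ^+ 3 * k (t * W x)) = \int[mu]_w (weight w * k (t * w)).
Proof.
move=> kc kK.
have mk : measurable_fun setT (fun w => k (t * w)).
  apply: (measurableT_comp (continuous_measurable_fun kc)).
  exact: measurable_funM.
have mv : measurable_fun setT (fun w : R => w ^+ 3 * k (t * w)).
  by apply: measurable_funM => //; exact: measurable_funX.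
rewrite -(Rintegral_density Wdens mv); last first.
  exact: (integrable_moment (measurable_funP W) integrable_cube t (leqnn 3) kc kK).
rewrite /Rintegral; congr fine; apply: ae_eq_integral => //.
- by apply/measurable_EFinP/measurable_funM.
- apply/measurable_EFinP/measurable_funM => //.
  by have /measurable_int /measurable_EFinP := integrable_weight.
(* The two integrands can differ only at the null point [b]. *)
- exists [set b]; split => //; first exact: lebesgue_measure_set1.
  move=> w /= /not_implyP[_ H]; apply: contrapT => wb; apply: H.
  rewrite weightE indicE mem_set//= mulr1; congr (_%:E); ring.
Qed.

(** Applied to a multiple of [slope], this gives F'(1) > 0; the factor 1 matches the derivative
    formula at t = 1. *)
Lemma Rintegral_square_gt0 (k : R -> R) (K : R) : continuous k ->
  (forall x, `|k x| <= K) -> (forall x, 0 < k x) ->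
  0 < \int[P]_x (W x ^+ 2 * k (1 * W x)).
Proof.
move=> kc kK k0.
have mv : measurable_fun setT (fun w : R => w ^+ 2 * k (1 * w)).
  apply: measurable_funM; first exact: measurable_funX.
  apply: (measurableT_comp (continuous_measurable_fun kc)).
  exact: measurable_funM.
have iv := integrable_moment (measurable_funP W) integrable_cube 1
  (isT : (2 <= 3)%N) kc kK.
rewrite -(Rintegral_density Wdens mv) //.
have [u [v [uv uvI]]] := interval_inside bc.
apply: (ge0_Rintegral_gt0 uv) => [|w|w uw wv].
- exact: (integrable_density Wdens mv iv).
- by rewrite mulr_ge0// mulr_ge0 ?sqr_ge0 ?ltW.
- have /andP[bw wc] := uvI w uw wv.
  have w0 : 0 < w by exact: le_lt_trans bw.
  apply: mulr_gt0; first by rewrite mulr_gt0 ?exprn_gt0.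
  rewrite wd_in; last by split => //; exact: ltW.
  by rewrite !mulr_gt0 ?powR_gt0 ?expR_gt0.
Qed.

End potts.

(** * The sign pattern of the second derivative of F *)

Unset Implicit Arguments.
Set Strict Implicit.
Set Printing Implicit Defensive.

Theorem theorem1p16 (R : realType) (d : measure_display)
  (T : measurableType d) (P : probability T R) (W : {RV P >-> R})
  (q : nat) (B : R) (C p : R) (phi : R -> R) (b : R) (c : \bar R)
  (D tau : R)
  (hB : 0 <= B)
  (hq : 1 < expR (- B) * (q%:R - 1))
  (hEW : (0 < 'E_P[W])%E)
  (hb : 0 <= b)
  (hbc : (b%:E < c)%E)
  (hC : 0 <= C)
  (hphi : nonneg_on (itv_co b c) phi)
  (hdens : has_density W (weight_density C p phi b c))
  (hD : 0 < D)
  (htau : 2 < tau)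
  (htail : forall w : R, 1 <= w ->
     (P [set x | w < W x]%R <= (D * w `^ (- (tau - 1)))%:E)%E)
  (hcases :
     [\/ [/\ 0 < b, (c < +oo)%E,
             C2_on (itv_cc b c) phi,
             nonneg_on (itv_cc b c)
               (fun w => w * derive_within (itv_cc b c) phi w) &
             nondecreasing_on (itv_cc b c)
               (fun w => w * derive_within (itv_cc b c) phi w)],
         [/\ 0 < b /\ c = +oo%E,
             C2_on (itv_cc b c) phi,
             nonneg_on (itv_cc b c)
               (fun w => w * derive_within (itv_cc b c) phi w),
             nondecreasing_on (itv_cc b c)
               (fun w => w * derive_within (itv_cc b c) phi w) &
             w * derive_within (itv_cc b c) phi w @[w --> +oo] --> +oo],
         [/\ b = 0 /\ (c < +oo)%E, -1 < p,
             C2_on (itv_cc b c) phi,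
             nonneg_on (itv_cc b c)
               (fun w => w * derive_within (itv_cc b c) phi w) &
             nondecreasing_on (itv_cc b c)
               (fun w => w * derive_within (itv_cc b c) phi w)] |
         [/\ b = 0 /\ c = +oo%E, -1 < p,
             C2_on (itv_cc b c) phi,
             nonneg_on (itv_cc b c)
               (fun w => w * derive_within (itv_cc b c) phi w) /\
             nondecreasing_on (itv_cc b c)
               (fun w => w * derive_within (itv_cc b c) phi w) &
             w * derive_within (itv_cc b c) phi w @[w --> +oo] --> +oo]]) :
  (forall t : R, 0 < t ->
     derivable (potts_F W q B) t 1 /\ derivable (derive1 (potts_F W q B)) t 1) /\
  first_positive_then_negative (derive1n 2 (potts_F W q B)).
Proof.
(* Dividing by e^B, the fraction (e^(x+B) - 1)/(e^(x+B) + q - 1) becomes 1 - kap/(e^x + a). *)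
set a := expR (- B) * (q%:R - 1) in hq; pose kap : R := q%:R * expR (- B).
have a0 : 0 < a by apply: lt_trans hq.
have q1 : 0 < (q%:R - 1 : R) by rewrite -(pmulr_rgt0 _ (expR_gt0 (- B))).
have kap0 : 0 < kap by rewrite mulr_gt0 ?expR_gt0//; lra.
pose dphi := derive_within (itv_cc b c) phi.
(* The four cases are reduced to three common facts; for bounded support the last one is vacuous. *)
have [phid [dphi_nd dphi_y]] :
    (forall x, itv_cc b c x -> derivable_within (itv_cc b c) phi x) /\
    nondecreasing_on (itv_cc b c) (fun w => w * dphi w) /\
    (c = +oo%E -> w * dphi w @[w --> +oo] --> +oo).
  case: hcases => [[? cy [? _ _] _ ?]|[_ [? _ _] _ ? ?]|[[_ cy] _ [? _ _] _ ?]|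
    [_ _ [? _ _] [_ ?] ?]]; split=> //; split=> // cE; by rewrite cE ltxx in cy.
have phiD w : b < w -> (w%:E < c)%E -> is_derive w (1 : R) phi (dphi w).
  move=> bw wc; apply: is_derive_within.
    by apply: inside_nbhs; rewrite /inside bw.
  by apply: phid; split; exact: ltW.
have {}dphi_nd v w : b < v -> v <= w -> (w%:E < c)%E ->
    v * dphi v <= w * dphi w.
  move=> bv vw wc; apply: dphi_nd => //; split; rewrite ?ltW//.
    by apply: le_lt_trans wc; rewrite lee_fin.
  exact: lt_le_trans vw.
have mW : measurable_fun setT (W : T -> R) by exact: measurable_funP.
have W3 := integrable_cube hb hbc hC hdens phiD dphi_y.
have iW : P.-integrable setT (fun x => (W x)%:E).
  have := @integrable_moment _ _ _ P W mW W3 1 (cst 1) 1 0 isT.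
  move=> H; apply: eq_integrable (H _ _) => //.
  - by move=> x _; rewrite /= expr1 mulr1.
  - by move=> x; exact: cvg_cst.
  - by move=> x; rewrite normr1.
pose m := fine 'E_P[W]%E.
have m0 : 0 < m.
  rewrite fine_gt0// hEW/= unlock ltey_eq integrable_fin_num//.
(* [u0] is the fraction in F as a function of x = t W, and [u1], [u2] are its first two derivatives;
   [M] bounds all three. *)
pose u0 x : R := 1 - kap * (expR x + a)^-1.
pose u1 x : R := kap * slope a x.
pose u2 x : R := kap * curvature a x.
pose M := 1 + kap / a.
have u0M x : `|u0 x| <= M.
  rewrite (le_trans (ler_normB _ _))// normr1 lerD2l normrM gtr0_norm//.
  have /andP[i0 i1] := inv_expRD_bound a0 x.
  by rewrite ler_pM2l// ger0_norm.
have u1M x : `|u1 x| <= M.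
  have u10 : 0 < u1 x by rewrite mulr_gt0// slope_gt0.
  rewrite gtr0_norm//; apply: ler_wpDl => //.
  by rewrite ler_pM2l// slope_le.
have u2M x : `|u2 x| <= M.
  rewrite normrM gtr0_norm//; apply: ler_wpDl => //.
  by rewrite ler_pM2l// curvature_bound.
have du0 (x : R) : is_derive x (1 : R) u0 (u1 x).
  have dv := is_deriveZ kap (is_derive_inv_expRD a0 x).
  have := is_deriveB (is_derive_cst (1 : R) x (1 : R)) dv.
  by rewrite sub0r scalerN opprK.
have du1 (x : R) : is_derive x (1 : R) u1 (u2 x).
  exact: (is_deriveZ kap (is_derive_slope a0 x)).
have cu1 : continuous u1.
  by move=> x; apply/differentiable_continuous/derivable1_diffP; apply: ex_derive.
have cu0 : continuous u0.
  by move=> x; apply/differentiable_continuous/derivable1_diffP; apply: ex_derive.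
have FE : potts_F W q B = fun t => m^-1 * \int[P]_x (W x ^+ 1 * u0 (t * W x)).
  have mE : fine (\int[P]_x (W x)%:E)%E = m by rewrite /m unlock.
  apply/funext => t; rewrite /potts_F unlock mE.
  rewrite -RintegralZl//; last first.
    exact: (integrable_moment mW W3 t (isT : (1 <= 3)%N) cu0 u0M).
  apply: eq_Rintegral => x _; rewrite /u0 /a /kap expRN expRD expr1.
  have eB := expR_gt0 B; have eW := expR_gt0 (t * W x).
  have d0 : 0 < expR (t * W x) * expR B + q%:R - 1.
    by rewrite -addrA addr_gt0// mulr_gt0.
  by field; rewrite addrA !gt_eqF.
have cc := continuous_curvature a0.
have cu2 : continuous u2.
  by move=> x; apply: cvgM; [exact: cvg_cst|exact: cc].
pose F1 t := m^-1 * \int[P]_x (W x ^+ 2 * u1 (t * W x)).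
pose F2 t := m^-1 * \int[P]_x (W x ^+ 3 * u2 (t * W x)).
have dF (t : R) : is_derive t (1 : R) (potts_F W q B) (F1 t).
  rewrite FE; exact: (is_deriveZ m^-1
    (is_derive_moment mW W3 t (isT : (1 < 3)%N) du0 cu1 u0M u1M)).
have dF1 (t : R) : is_derive t (1 : R) F1 (F2 t).
  exact: (is_deriveZ m^-1
    (is_derive_moment mW W3 t (isT : (2 < 3)%N) du1 cu2 u1M u2M)).
have F1E : derive1 (potts_F W q B) = F1.
  by apply/funext => t; rewrite derive1E; exact: derive_val.
have F2E : derive1n 2 (potts_F W q B) = F2.
  by apply/funext => t; rewrite /= F1E derive1E; exact: derive_val.
split; first by move=> t _; rewrite F1E; split; exact: ex_derive.
rewrite F2E.
have C0 := weight_density_scale_gt0 hC hdens.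
have iw := integrable_weight hb hbc hC hdens phiD dphi_y.
have kb := curvature_bound a0.
have lna0 : 0 < ln a by exact: ln_gt0.
have k_gt0 x : x < ln a -> 0 < curvature a x.
  by move=> xa; apply: curvature_gt0 => //; rewrite -[ltRHS]lnK ?posrE// ltr_expR.
have k_lt0 x : ln a < x -> curvature a x < 0.
  by move=> xa; apply: curvature_lt0 => //; rewrite -[ltLHS]lnK ?posrE// ltr_expR.
pose I := kernel_integral b c C (p + 3%:R) phi (curvature a).
have IE t : \int[P]_x (W x ^+ 3 * curvature a (t * W x)) = I t.
  exact: (Rintegral_cube_weight hb hbc hC hdens phiD dphi_y t cc kb).
have F2I t : F2 t = kap / m * I t.
  rewrite /F2 -IE [kap / m]mulrC -mulrA; congr (_ * _).
  rewrite -RintegralZl//; last first.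
    exact: (integrable_moment mW W3 t (leqnn 3) cc kb).
  by apply: eq_Rintegral => x _; rewrite /u2 mulrCA.
have km0 : 0 < kap / m by rewrite divr_gt0.
apply: single_crossing.
(* Since a > 1, the kernel is positive at 0 < ln a. *)
- have I0 : 0 < I 0.
    apply: (kernel_integral_gt0 hb hbc C0 iw cc kb) => w _.
    by rewrite mul0r k_gt0.
  have := continuous_moment (t := 0) mW W3 (leqnn 3) cc kb.
  rewrite (_ : (fun t => _) = I); last by apply/funext => t; exact: IE.
  (* The tolerance [I 0] itself keeps [I t] positive near 0. *)
  move=> /cvgrPdist_lt/(_ _ I0) /nbhs_ballP[e /= e0 eI].
  exists e; split => // t t0 te; rewrite F2I mulr_gt0//.
  have := eI t; rewrite /ball/= sub0r normrN gtr0_norm// => /(_ te).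
  by rewrite ltr_norml => /andP[_]; lra.
(* The bound on |F| comes from |u0| <= M and the integrability of [W]. *)
- apply: (@exists_nonpos_derivative2 _ (potts_F W q B) F1 F2
    (m^-1 * \int[P]_x (M * `|W x|))) => //.
  + move=> t _; rewrite FE normrM gtr0_norm ?invr_gt0// ler_pM2l ?invr_gt0//.
    have i0 := integrable_moment mW W3 t (isT : (1 <= 3)%N) cu0 u0M.
    apply: le_trans (le_normr_Rintegral measurableT i0) _.
    apply: le_Rintegral => //.
    - exact: (integrable_norm i0).
    - rewrite /comp; under eq_fun do rewrite EFinM.
      by apply: integrableZl => //; exact: (integrable_norm iW).
    - by move=> x _; rewrite expr1 normrM mulrC ler_wpM2r.
  + rewrite mulr_gt0 ?invr_gt0//.
    apply: (Rintegral_square_gt0 hb hbc hC hdens phiD dphi_y cu1 u1M) => x.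
    by rewrite mulr_gt0// slope_gt0.
- move=> t1 t2 t10 t12; rewrite !F2I pmulr_rle0// pmulr_rlt0//.
  exact: (kernel_integral_crossing hb hbc C0 phiD dphi_nd dphi_y iw lna0
    k_gt0 k_lt0 cc kb).
Qed.
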